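(* Let $k$ be a field, let $d\ge 1$, and let $X$ be the $d$-dimensional projective nonreduced $k$-scheme consisting of a double linear hyperplane in $\mathbb P^{d+1}_k$. There exists a graded linear series $L=\bigoplus_{n\ge 0}L_n$ for $\mathcal O_X(2)$ with maximal Kodaira-Iitaka dimension $q(L)=d$, such that the limit $$\lim_{n\rightarrow \infty} \frac{\dim_k(L_n)}{n^d}$$ does not exist, even when $n$ is constrained to lie in any arithmetic sequence; that is, for all $a\in\mathbb N$ and all positive integers $r$, the limit of $\dim_k(L_n)/n^d$ as $n\to\infty$ with $n\in\{a+br\mid b\in\mathbb N\}$ does not exist.
   Context: The double linear hyperplane is $X=\mathrm{Proj}(k[x_0,x_1,\ldots,x_{d+1}]/(x_1^2))$ for suitable homogeneous coordinates on $\mathbb P^{d+1}_k$. For a line bundle $\mathcal L$ on a projective scheme $X$ over a field $k$, a graded linear series for $\mathcal L$ is a graded $k$-subalgebra $L=\bigoplus_{n\ge 0}L_n$ of the section ring $\bigoplus_{n\ge 0}\Gamma(X,\mathcal L^n)$, where $\mathcal L^n=\mathcal L^{\otimes n}$ and $L_n\subset\Gamma(X,\mathcal L^n)$. Let $\sigma(L)$ be the maximum $m$ such that there exist $y_1,\ldots,y_m\in L$ which are homogeneous of positive degree and algebraically independent over $k$ ($\sigma(L)=0$ if there are no such elements with $m\ge 1$). The Kodaira-Iitaka dimension is $q(L)=\sigma(L)-1$ if $\sigma(L)>0$, and $q(L)=-\infty$ if $\sigma(L)=0$. *)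

(* Defs.v *)
From HB Require Import structures.
From mathcomp Require Import all_boot all_order all_algebra.
From mathcomp Require Import mpoly ring zify.
From mathcomp Require Import boolp classical_sets constructive_ereal.

Set Implicit Arguments.
Unset Strict Implicit.
Unset Printing Implicit Defensive.

Import GRing.Theory.

Local Open Scope classical_set_scope.
Local Open Scope ring_scope.
Local Open Scope quotient_scope.

Record multset (A : comNzRingType) := Multset {
  mset : set A;
  mset0 : ~ mset 0;
  mset1 : mset 1;
  msetM : forall a b, mset a -> mset b -> mset (a * b) }.

Module Localization.
Section Localization.
Variables (k : pzRingType) (A : comAlgType k) (M : multset A).

Local Notation S := (mset M).
Local Notation dom := (A * S)%type.
Implicit Types x y z : dom.

Lemma denP (s : S) : S (val s).
Proof. exact: set_mem (valP s). Qed.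

Definition den1 : S := exist _ 1 (mem_set (mset1 M)).
Definition denM (s t : S) : S :=
  exist _ (val s * val t) (mem_set (msetM (denP s) (denP t))).

(* a / s = b / t iff u (a t - b s) = 0 for some u in S *)
Definition equivl x y :=
  `[< exists2 u, S u & u * (x.1 * val y.2) = u * (y.1 * val x.2) >].

Lemma equivl_refl : reflexive equivl.
Proof. by move=> x; apply/asboolP; exists 1 => //; exact: mset1. Qed.

Lemma equivl_sym : ssrbool.symmetric equivl.
Proof.
by move=> x y; apply/asboolP/asboolP => -[u Su e]; exists u.
Qed.

Lemma equivl_trans : transitive equivl.
Proof.
move=> y x z /asboolP[u Su e] /asboolP[v Sv f]; apply/asboolP.
exists (u * v * val y.2); first by do 2?apply: msetM => //; exact: denP.
have -> : u * v * val y.2 * (x.1 * val z.2) =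
          u * (x.1 * val y.2) * (v * val z.2) by ring.
have -> : u * v * val y.2 * (z.1 * val x.2) =
          v * (z.1 * val y.2) * (u * val x.2) by ring.
by rewrite e -f; ring.
Qed.

Canonical equivl_equiv := EquivRel equivl equivl_refl equivl_sym equivl_trans.

Definition type := {eq_quot equivl}.
HB.instance Definition _ : EqQuotient _ equivl type := EqQuotient.on type.
HB.instance Definition _ := Choice.on type.

Lemma eqlP x y : reflect
  (exists2 u, S u & u * (x.1 * val y.2) = u * (y.1 * val x.2))
  (x == y %[mod type]).
Proof. by rewrite eqmodE; exact: asboolP. Qed.

Lemma eql x y : x.1 * val y.2 = y.1 * val x.2 -> \pi_type x = \pi_type y.
Proof. by move=> e; apply/eqP/eqlP; exists 1; [exact: mset1 | rewrite e]. Qed.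

Definition addl x y : dom := (x.1 * val y.2 + y.1 * val x.2, denM x.2 y.2).
Definition oppl x : dom := (- x.1, x.2).
Definition mull x y : dom := (x.1 * y.1, denM x.2 y.2).
Definition scalel (c : k) x : dom := (c *: x.1, x.2).

Lemma reprl x : exists2 u, S u &
  u * ((repr (\pi_type x)).1 * val x.2) = u * (x.1 * val (repr (\pi_type x)).2).
Proof. by apply/eqlP; rewrite reprK. Qed.

Definition zero : type := \pi_type (0, den1).
Definition one : type := \pi_type (1, den1).
Definition add := lift_op2 type addl.
Definition opp := lift_op1 type oppl.
Definition mul := lift_op2 type mull.
Definition scale c := lift_op1 type (scalel c).

Lemma pi_add x y : add (\pi_type x) (\pi_type y) = \pi_type (addl x y).
Proof.
have [u Su e] := reprl x; have [v Sv f] := reprl y; move: e f; unlock add.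
case: x (repr _) => a [s Ss] [a' [s' Ss']].
case: y (repr _) => b [t St] [b' [t' St']] /= e f.
apply/eqP/eqlP; exists (u * v) => /=; first exact: msetM.
have -> : u * v * ((a' * t' + b' * s') * (s * t)) =
  u * (a' * s) * (v * t' * t) + v * (b' * t) * (u * s' * s) by ring.
by rewrite e f; ring.
Qed.

Lemma pi_opp x : opp (\pi_type x) = \pi_type (oppl x).
Proof.
have [u Su e] := reprl x; move: e; unlock opp.
case: x (repr _) => a [s Ss] [a' [s' Ss']] /= e.
by apply/eqP/eqlP; exists u => //=; rewrite !mulNr !mulrN e.
Qed.

Lemma pi_mul x y : mul (\pi_type x) (\pi_type y) = \pi_type (mull x y).
Proof.
have [u Su e] := reprl x; have [v Sv f] := reprl y; move: e f; unlock mul.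
case: x (repr _) => a [s Ss] [a' [s' Ss']].
case: y (repr _) => b [t St] [b' [t' St']] /= e f.
apply/eqP/eqlP; exists (u * v) => /=; first exact: msetM.
have -> : u * v * (a' * b' * (s * t)) = u * (a' * s) * (v * (b' * t)) by ring.
by rewrite e f; ring.
Qed.

Lemma pi_scale c x : scale c (\pi_type x) = \pi_type (scalel c x).
Proof.
have [u Su e] := reprl x; move: e; unlock scale.
case: x (repr _) => a [s Ss] [a' [s' Ss']] /= e.
by apply/eqP/eqlP; exists u => //=; rewrite -!scalerAl -!scalerAr e.
Qed.

Local Ltac ringl := apply: eql => /=; ring.

Lemma addA : associative add.
Proof.
elim/quotW=> -[a [s ?]]; elim/quotW=> -[b [t ?]]; elim/quotW=> -[c [r ?]].
by rewrite !pi_add; ringl.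
Qed.

Lemma addC : commutative add.
Proof.
by elim/quotW=> -[a [s ?]]; elim/quotW=> -[b [t ?]]; rewrite !pi_add; ringl.
Qed.

Lemma add0l : left_id zero add.
Proof. by elim/quotW=> -[a [s ?]]; rewrite pi_add; ringl. Qed.

Lemma addNl : left_inverse zero opp add.
Proof. by elim/quotW=> -[a [s ?]]; rewrite pi_opp pi_add; ringl. Qed.

HB.instance Definition _ := GRing.isZmodule.Build type addA addC add0l addNl.

Lemma mulA : associative mul.
Proof.
elim/quotW=> -[a [s ?]]; elim/quotW=> -[b [t ?]]; elim/quotW=> -[c [r ?]].
by rewrite !pi_mul; ringl.
Qed.

Lemma mulC : commutative mul.
Proof.
by elim/quotW=> -[a [s ?]]; elim/quotW=> -[b [t ?]]; rewrite !pi_mul; ringl.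
Qed.

Lemma mul1l : left_id one mul.
Proof. by elim/quotW=> -[a [s ?]]; rewrite pi_mul; ringl. Qed.

Lemma mulDl : left_distributive mul add.
Proof.
elim/quotW=> -[a [s ?]]; elim/quotW=> -[b [t ?]]; elim/quotW=> -[c [r ?]].
by rewrite pi_add !pi_mul pi_add; ringl.
Qed.

Lemma one_neq0 : one != zero.
Proof.
apply/negP => /eqlP[u Su /=]; rewrite !mulr1 mulr0 => u0.
by case: (@mset0 _ M); rewrite -u0.
Qed.

HB.instance Definition _ :=
  GRing.Zmodule_isComNzRing.Build type mulA mulC mul1l mulDl one_neq0.

Lemma scaleA c c' a : scale c (scale c' a) = scale (c * c') a.
Proof.
by elim/quotW: a => x; rewrite !pi_scale; apply: eql; rewrite /= scalerA.
Qed.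

Lemma scale1 : left_id 1 scale.
Proof. by elim/quotW=> x; rewrite pi_scale; apply: eql; rewrite /= scale1r. Qed.

Lemma scaleDr : right_distributive scale +%R.
Proof.
move=> c; elim/quotW=> x; elim/quotW=> y; rewrite -!/(add _ _).
rewrite [in LHS]/GRing.add [in RHS]/GRing.add /=.
rewrite pi_add !pi_scale pi_add; apply: eql => /=.
by rewrite scalerDr -!scalerAl.
Qed.

Lemma scaleDl a : {morph scale^~ a : c c' / c + c'}.
Proof.
move=> c c'; elim/quotW: a => x; rewrite [in RHS]/GRing.add /=.
rewrite !pi_scale pi_add; apply: eql => /=.
by rewrite scalerDl !mulrDl -!scalerAl mulrA (mulrAC _ (val x.2)).
Qed.

HB.instance Definition _ :=
  GRing.Zmodule_isLmodule.Build k type scaleA scale1 scaleDr scaleDl.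

Lemma scaleAl c (a b : type) : c *: (a * b) = c *: a * b.
Proof.
elim/quotW: a => x; elim/quotW: b => y.
rewrite /GRing.scale /GRing.mul /= !(pi_mul, pi_scale) .
by apply: eql => /=; rewrite -!scalerAl.
Qed.

HB.instance Definition _ := GRing.Lmodule_isLalgebra.Build k type scaleAl.
HB.instance Definition _ := GRing.Lalgebra_isComAlgebra.Build k type.

Definition frac (a s : A) (Ss : S s) : type := \pi_type (a, exist _ s (mem_set Ss)).

End Localization.
End Localization.
HB.export Localization.

Notation localization := Localization.type.
Notation frac := Localization.frac.

Section QuotientAlgebra.
Variables (k : pzRingType) (A : comAlgType k) (I : idealr A).
Local Notation Q := {ideal_quot I}.

Definition qscale (c : k) := lift_op1 Q (fun a : A => c *: a).

Lemma pi_qscale c (a : A) : qscale c (\pi_Q a) = \pi_Q (c *: a).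
Proof.
unlock qscale; apply/eqP; rewrite -Quotient.idealrBE -scalerBr -mulr_algl.
by apply: idealMr; rewrite Quotient.idealrBE reprK.
Qed.

Lemma qscaleA c c' a : qscale c (qscale c' a) = qscale (c * c') a.
Proof. by elim/quotW: a => a; rewrite !pi_qscale scalerA. Qed.

Lemma qscale1 : left_id 1 qscale.
Proof. by elim/quotW=> a; rewrite pi_qscale scale1r. Qed.

Lemma qscaleDr : right_distributive qscale +%R.
Proof.
move=> c; elim/quotW=> a; elim/quotW=> b.
by rewrite -pi_addr !pi_qscale -pi_addr scalerDr.
Qed.

Lemma qscaleDl a : {morph qscale^~ a : c c' / c + c'}.
Proof.
by move=> c c'; elim/quotW: a => a; rewrite !pi_qscale -pi_addr scalerDl.
Qed.

HB.instance Definition _ :=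
  GRing.Zmodule_isLmodule.Build k Q qscaleA qscale1 qscaleDr qscaleDl.

Lemma qscaleAl c (a b : Q) : c *: (a * b) = c *: a * b.
Proof.
elim/quotW: a => a; elim/quotW: b => b.
by rewrite -pi_mulr /GRing.scale /= !pi_qscale -pi_mulr scalerAl.
Qed.

HB.instance Definition _ := GRing.Lmodule_isLalgebra.Build k Q qscaleAl.
HB.instance Definition _ := GRing.Lalgebra_isComAlgebra.Build k Q.

End QuotientAlgebra.

Record grading (k : pzRingType) (A : comAlgType k) := Grading {
  gr : nat -> set A;
  gr0 : forall n, gr n 0;
  grP : forall n c a b, gr n a -> gr n b -> gr n (c *: a + b);
  gr1 : gr 0 1;
  grM : forall m n a b, gr m a -> gr n b -> gr (m + n) (a * b);
  gr_gen : forall a, exists N (f : nat -> A),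
    (forall i, gr i (f i)) /\ a = \sum_(i < N) f i;
  gr_direct : forall N (f : nat -> A), (forall i, gr i (f i)) ->
    \sum_(i < N) f i = 0 -> forall i, (i < N)%N -> f i = 0 }.

Section Proj.
Variables (k : pzRingType) (A : comAlgType k) (G : grading A).

(* A point of Proj A: a homogeneous prime ideal not containing the irrelevant
   ideal \bigoplus_(n > 0) A_n. *)
Record proj := ProjPoint {
  pt : set A;
  pt0 : pt 0;
  ptD : forall a b, pt a -> pt b -> pt (a + b);
  ptM : forall a b, pt b -> pt (a * b);
  pt1 : ~ pt 1;
  pt_prime : forall a b, pt (a * b) -> pt a \/ pt b;
  pt_homog : forall a, pt a -> exists N (f : nat -> A),
    (forall i, gr G i (f i) /\ pt (f i)) /\ a = \sum_(i < N) f i;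
  pt_relevant : exists n a, [/\ (0 < n)%N, gr G n a & ~ pt a] }.

Definition den_set (x : proj) : set A :=
  [set s | (exists n, gr G n s) /\ ~ pt x s].

Lemma den_set0 x : ~ den_set x 0.
Proof. by case=> _; apply; exact: pt0. Qed.

Lemma den_set1 x : den_set x 1.
Proof. by split; [exists 0%N; exact: gr1 | exact: pt1]. Qed.

Lemma den_setM x a b : den_set x a -> den_set x b -> den_set x (a * b).
Proof.
move=> [[m Ga] xa] [[n Gb] xb]; split; first by exists (m + n)%N; exact: grM.
by move=> /pt_prime[].
Qed.

Definition den (x : proj) : multset A :=
  Multset (@den_set0 x) (@den_set1 x) (@den_setM x).

(* T^-1 A for T the homogeneous elements outside x; its degree n part is the
   stalk of O(n) at x. *)
Definition loc (x : proj) := localization (den x).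

(* Not necessarily continuous families of germs. As each loc x is graded, the
   section ring \bigoplus_n Gamma(Proj A, O(n)) is a subring of this ring. *)
Definition germs := forall x : proj, loc x.

HB.instance Definition _ := gen_eqMixin germs.
HB.instance Definition _ := gen_choiceMixin germs.

Implicit Types s t u : germs.

Definition germs_zero : germs := fun=> 0.
Definition germs_one : germs := fun=> 1.
Definition germs_opp s : germs := fun x => - s x.
Definition germs_add s t : germs := fun x => s x + t x.
Definition germs_mul s t : germs := fun x => s x * t x.
Definition germs_scale (c : k) s : germs := fun x => c *: s x.

Lemma germs_addA : associative germs_add.
Proof. by move=> s t u; apply: functional_extensionality_dep => x; exact: addrA. Qed.
Lemma germs_addC : commutative germs_add.
Proof. by move=> s t; apply: functional_extensionality_dep => x; exact: addrC. Qed.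
Lemma germs_add0 : left_id germs_zero germs_add.
Proof. by move=> s; apply: functional_extensionality_dep => x; exact: add0r. Qed.
Lemma germs_addN : left_inverse germs_zero germs_opp germs_add.
Proof. by move=> s; apply: functional_extensionality_dep => x; exact: addNr. Qed.

HB.instance Definition _ :=
  GRing.isZmodule.Build germs germs_addA germs_addC germs_add0 germs_addN.

Lemma germs_mulA : associative germs_mul.
Proof. by move=> s t u; apply: functional_extensionality_dep => x; exact: mulrA. Qed.
Lemma germs_mulC : commutative germs_mul.
Proof. by move=> s t; apply: functional_extensionality_dep => x; exact: mulrC. Qed.
Lemma germs_mul1 : left_id germs_one germs_mul.
Proof. by move=> s; apply: functional_extensionality_dep => x; exact: mul1r. Qed.
Lemma germs_mulDl : left_distributive germs_mul +%R.
Proof. by move=> s t u; apply: functional_extensionality_dep => x; exact: mulrDl. Qed.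

HB.instance Definition _ := GRing.Zmodule_isComPzRing.Build germs
  germs_mulA germs_mulC germs_mul1 germs_mulDl.

Lemma germs_scaleA c c' s :
  germs_scale c (germs_scale c' s) = germs_scale (c * c') s.
Proof. by apply: functional_extensionality_dep => x; exact: scalerA. Qed.
Lemma germs_scale1 : left_id 1 germs_scale.
Proof. by move=> s; apply: functional_extensionality_dep => x; exact: scale1r. Qed.
Lemma germs_scaleDr : right_distributive germs_scale +%R.
Proof. by move=> c s t; apply: functional_extensionality_dep => x; exact: scalerDr. Qed.
Lemma germs_scaleDl s : {morph germs_scale^~ s : c c' / c + c'}.
Proof. by move=> c c'; apply: functional_extensionality_dep => x; exact: scalerDl. Qed.

HB.instance Definition _ := GRing.Zmodule_isLmodule.Build k germs
  germs_scaleA germs_scale1 germs_scaleDr germs_scaleDl.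

(* Gamma(Proj A, O(n)): every point x has a basic open neighbourhood D(h), h
   homogeneous, on which s is a single fraction f / g of degree n. *)
Definition twist_sections (n : nat) : set germs := [set s |
  forall x : proj, exists e f g h,
    [/\ gr G (n + e) f, gr G e g, den_set x h &
     forall y : proj, ~ pt y h ->
       exists gy : mset (den y) g, s y = frac f gy]].

(* A graded linear series for O(e), given by its graded pieces; the n-th tensor
   power of O(e) is identified with O(e * n) (A generated in degree 1). *)
Record graded_linear_series (e : nat) := GradedLinearSeries {
  gls :> nat -> set germs;
  gls_sub : forall n, gls n `<=` twist_sections (e * n);
  gls0 : forall n, gls n 0;
  glsP : forall n c s t, gls n s -> gls n t -> gls n (c *: s + t);
  gls1 : gls 0 1;
  glsM : forall m n s t, gls m s -> gls n t -> gls (m + n) (s * t) }.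

End Proj.

Section LinearSeries.
Variables (k : fieldType) (A : comAlgType k) (G : grading A).

Definition alg_indep m (y : 'I_m -> germs G) :=
  forall P : {mpoly k[m]},
    \sum_(u <- msupp P) P@_u *: \prod_(i < m) y i ^+ u i = 0 -> P = 0.

Definition has_indep e (L : graded_linear_series G e) (m : nat) :=
  exists2 y : 'I_m -> germs G,
    (forall i, exists2 n, (0 < n)%N & L n (y i)) & alg_indep y.

Definition is_sigma e (L : graded_linear_series G e) (m : nat) :=
  has_indep L m /\ forall m', has_indep L m' -> (m' <= m)%N.

Definition is_kodaira_iitaka_dim e (L : graded_linear_series G e)
    (q : \bar int) :=
  exists2 m, is_sigma L m & q = if m is m'.+1 then (m'%:Z)%:E else -oo%E.

End LinearSeries.

Definition has_dim (k : fieldType) (V : lmodType k) (W : set V) (m : nat) :=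
  exists v : 'I_m -> V, [/\ forall i, W (v i),
    forall c : 'I_m -> k, \sum_i c i *: v i = 0 -> forall i, c i = 0 &
    forall w, W w -> exists c : 'I_m -> k, w = \sum_i c i *: v i].

Section DoubleHyperplane.
Variables (k : fieldType) (d : nat).
Local Notation S := {mpoly k[d.+2]}.

Definition i1 : 'I_d.+2 := @Ordinal d.+2 1 isT.

Definition sq_ideal : {pred S} := fun p => `[< exists q, p = q * 'X_i1 ^+ 2 >].

Lemma sq_idealP p : reflect (exists q, p = q * 'X_i1 ^+ 2) (p \in sq_ideal).
Proof. exact: asboolP. Qed.

Lemma sq_ideal_closed : idealr_closed sq_ideal.
Proof.
split.
- by apply/sq_idealP; exists 0; rewrite mul0r.
- apply/sq_idealP => -[q /(congr1 (fun p => p.@[fun=> 0]))].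
  rewrite rmorph1 rmorphM rmorphXn /= mevalXU expr0n mulr0.
  by move/eqP; rewrite oner_eq0.
- move=> a p q /sq_idealP[p' ->] /sq_idealP[q' ->].
  by apply/sq_idealP; exists (a * p' + q'); rewrite mulrDl mulrA.
Qed.

HB.instance Definition _ := isIdealr.Build S sq_ideal sq_ideal_closed.

Definition coord_ring := {ideal_quot sq_ideal}.
HB.instance Definition _ := GRing.ComAlgebra.on coord_ring.

Lemma pi_coord_ring0 p : \pi_coord_ring p = 0 <-> p \in sq_ideal.
Proof.
rewrite -{2}[p]subr0 Quotient.idealrBE.
by split=> [p0|/eqP ->]; [apply/eqP|]; rewrite pi_zeror.
Qed.

Lemma sq_ideal_supp p :
  (p \in sq_ideal) <-> (forall m : 'X_{1..d.+2}, (m i1 < 2)%N -> p@_m = 0).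
Proof.
split=> [/sq_idealP[q ->] m m2|p0].
  rewrite mpolyXn mcoeffMr big1 // => -[u v] /= /eqP e.
  rewrite mcoeffX; case: eqP => [u2|]; last by rewrite mulr0.
  have := congr1 (fun w : 'X_{1..d.+2} => w i1) e.
  by rewrite mnmDE -u2 mulmnE mnm1E eqxx; lia.
apply/sq_idealP.
exists (\sum_(m <- msupp p) p@_m *: 'X_[m - U_(i1) *+ 2]).
rewrite mulr_suml {1}(mpolyE p) big_seq [RHS]big_seq; apply: eq_bigr => m mp.
rewrite -scalerAl mpolyXn -mpolyXD submK //.
apply/mnm_lepP => i; rewrite mulmnE mnm1E.
case: eqP => [<-|] //; rewrite leqNgt; apply: contraTN mp => m2.
by rewrite -mcoeff_eq0 p0.
Qed.

Definition coord_gr (n : nat) : set coord_ring :=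
  [set \pi_coord_ring p | p in [set p : S | p \is n.-homog]].

Lemma coord_gr0 n : coord_gr n 0.
Proof. by exists 0; [exact: dhomog0 | rewrite pi_zeror]. Qed.

Lemma coord_grP n (c : k) a b :
  coord_gr n a -> coord_gr n b -> coord_gr n (c *: a + b).
Proof.
move=> [p hp <-] [q hq <-]; exists (c *: p + q).
  by apply: rpredD => //; exact: rpredZ.
by rewrite pi_addr -pi_qscale.
Qed.

Lemma coord_gr1 : coord_gr 0 1.
Proof. by exists 1; [exact: dhomog1 | rewrite pi_oner]. Qed.

Lemma coord_grM m n a b :
  coord_gr m a -> coord_gr n b -> coord_gr (m + n) (a * b).
Proof.
move=> [p hp <-] [q hq <-]; exists (p * q); first exact: dhomogM.
by rewrite pi_mulr.
Qed.

Lemma coord_gr_gen a : exists N (f : nat -> coord_ring),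
  (forall i, coord_gr i (f i)) /\ a = \sum_(i < N) f i.
Proof.
elim/quotW: a => p; exists (msize p), (fun i => \pi_coord_ring (pihomog mdeg i p)).
split=> [i|]; first by exists (pihomog mdeg i p) => //; exact: pihomogP.
by rewrite -raddf_sum /= -pihomog_partitionE.
Qed.

Lemma coord_gr_direct N (f : nat -> coord_ring) :
  (forall i, coord_gr i (f i)) -> \sum_(i < N) f i = 0 ->
  forall i, (i < N)%N -> f i = 0.
Proof.
move=> hf; have /choice[g hg] i : exists p : S,
  p \is i.-homog /\ \pi_coord_ring p = f i by have [p ? ?] := hf i; exists p.
under eq_bigr do rewrite -(hg _).2.
rewrite -raddf_sum => /pi_coord_ring0/sq_ideal_supp sN0 i iN.
rewrite -(hg i).2; apply/pi_coord_ring0/sq_ideal_supp => m m2.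
have [mi|mi] := eqVneq (mdeg m) i; last exact: dhomog_nemf_coeff (hg i).1 mi.
rewrite -(sN0 m m2) raddf_sum (bigD1 (Ordinal iN)) //= big1 ?addr0 // => j ji.
have mj : mdeg m != j by rewrite mi eq_sym.
exact: dhomog_nemf_coeff (hg j).1 mj.
Qed.

(* The scheme is proj of this graded algebra k[x_0, ..., x_(d+1)] / (x_1 ^ 2). *)
Definition double_hyperplane : grading coord_ring :=
  Grading coord_gr0 coord_grP coord_gr1 coord_grM coord_gr_gen coord_gr_direct.

End DoubleHyperplane.

(* Main.v *)
(* Write t_0 = x_0, t_j = x_(j+1) for 1 <= j <= d, and N = x_1, so N ^ 2 = 0. A
   section of O(2n) is f + N g with f, g forms in t of degrees 2n and 2n - 1.
   Let L_n be spanned by the monomials t^u of degree 2n with d u_j <= n for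
   j >= 1, and by the N t^u of degree 2n with d u_j + 1 <= n + sigma(n) for
   j >= 1. Since N ^ 2 = 0, closure under products only requires sigma to be
   nondecreasing. Counting boxes gives dim L_n ~ (n/d)^d + ((n + sigma(n))/d)^d.
   For sigma(n) the largest power of 2 up to n, sigma(n)/n is close to 1 just
   after a power of 2 and close to 1/2 just before the next one, and every
   arithmetic progression meets both kinds of n. *)
Require Import Defs.
From HB Require Import structures.
From mathcomp Require Import all_boot all_order all_algebra.
From mathcomp Require Import mpoly ring zify lra.
From mathcomp Require Import boolp classical_sets reals constructive_ereal.
From mathcomp Require Import topology normedtype sequences.
Import Order.TTheory GRing.Theory Num.Theory numFieldNormedType.Exports.
Local Open Scope classical_set_scope.
Local Open Scope ring_scope.
Local Open Scope quotient_scope.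

Set Implicit Arguments.
Unset Strict Implicit.
Unset Printing Implicit Defensive.

(** * Elements of a graded algebra as global families of germs *)

Section GermsOfElements.
Variables (k : pzRingType) (A : comAlgType k) (G : grading A).

Definition to_germs (a : A) : germs G :=
  fun x => Localization.frac a (mset1 (den x)).

Lemma to_germs_is_linear : linear to_germs.
Proof.
move=> c a b; apply: functional_extensionality_dep => x.
rewrite /to_germs /Localization.frac.
rewrite -[RHS]/(Localization.add (Localization.scale c _) _).
rewrite Localization.pi_scale Localization.pi_add.
by apply: Localization.eql => /=; rewrite !mulr1.
Qed.

HB.instance Definition _ :=
  GRing.isLinear.Build k A (germs G) _ to_germs to_germs_is_linear.

Lemma to_germs_is_monoid_morphism : monoid_morphism to_germs.
Proof.
split=> [|a b]; apply: functional_extensionality_dep => x.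
  exact: Localization.eql.
rewrite -[RHS]/(Localization.mul _ _) Localization.pi_mul.
by apply: Localization.eql => /=; rewrite !mulr1.
Qed.

HB.instance Definition _ :=
  GRing.isMonoidMorphism.Build A (germs G) to_germs to_germs_is_monoid_morphism.

Lemma to_germs_twist n a : gr G n a -> twist_sections n (to_germs a).
Proof.
move=> an x; exists 0%N, a, 1, 1; split; rewrite ?addn0 //.
- exact: gr1.
- exact: den_set1.
- by move=> y _; exists (mset1 (den y)).
Qed.

(** Vanishing at the single point [x] already gives this: [a / 1 = 0] in the localization means that
    some denominator, hence some element outside the prime [x], kills [a]. *)
Lemma to_germs_eq0 (x : proj G) a :
  to_germs a = 0 -> exists2 u, ~ pt x u & u * a = 0.
Proof.
move=> /(congr1 (fun s : germs G => s x)) /eqP /Localization.eqlP[u [_ xu]] /=.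
by rewrite !mulr1 mulr0 => ua; exists u.
Qed.

End GermsOfElements.

(** * Divisibility by a variable in a polynomial ring *)

Section VariableDivides.
Variables (R : idomainType) (n : nat) (i : 'I_n).
Local Notation S := {mpoly R[n]}.

(** Reduction modulo ['X_i], realised as the substitution of 0 for ['X_i] inside the same ring. The
    target is thus a domain, which makes ['X_i] prime. *)
Definition kill_var (p : S) : S :=
  p \mPo [tuple if j == i then 0 else 'X_j | j < n].

Lemma kill_varM p q : kill_var (p * q) = kill_var p * kill_var q.
Proof. exact: rmorphM. Qed.

Lemma kill_varX m : kill_var 'X_[m] = if m i == 0%N then 'X_[m] else 0.
Proof.
rewrite /kill_var comp_mpolyX; case: eqP => [mi|/eqP mi].
  rewrite [RHS]mpolyXE_id; apply: eq_bigr => j _.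
  by rewrite tnth_mktuple; case: eqP => // ->; rewrite mi !expr0.
by rewrite (bigD1 i) //= tnth_mktuple eqxx expr0n (negPf mi) mul0r.
Qed.

Lemma mcoeff_kill_var p (m : 'X_{1..n}) : m i = 0%N -> (kill_var p)@_m = p@_m.
Proof.
move=> mi; rewrite /kill_var comp_mpolyEX raddf_sum [p in RHS]mpolyE raddf_sum.
apply: eq_bigr => u _; rewrite -/(kill_var _) kill_varX /= !mcoeffZ.
case: eqP => // ui; rewrite mcoeff0 mcoeffX; case: eqP => // um.
by rewrite um in ui.
Qed.

(** For the converse, the coefficients at monomials free of ['X_i] are unchanged by [kill_var]; if
    they all vanish, every monomial of [p] can be divided by ['X_i]. *)
Lemma var_dvdP p : (exists q, p = q * 'X_i) <-> kill_var p = 0.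
Proof.
split=> [[q ->]|p0].
  by rewrite kill_varM kill_varX mnm1E eqxx mulr0.
exists (\sum_(m <- msupp p) p@_m *: 'X_[m - U_(i)]).
rewrite mulr_suml {1}(mpolyE p) big_seq [RHS]big_seq; apply: eq_bigr => m mp.
rewrite -scalerAl -mpolyXD submK // lep1mP; apply: contraTneq mp => mi.
by rewrite -mcoeff_eq0 -(mcoeff_kill_var _ mi) p0 mcoeff0.
Qed.

Lemma var_prime p q :
  kill_var (p * q) = 0 -> kill_var p = 0 \/ kill_var q = 0.
Proof. by rewrite kill_varM => /eqP; rewrite mulf_eq0 => /orP[]/eqP; auto. Qed.

(** The ideal generated by ['X_i ^+ 2] is primary: since ['X_i] is prime and does not divide [u], it
    can be split off from [p] twice. *)
Lemma var_cancel_sq u p : kill_var u != 0 ->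
  (exists q, u * p = q * 'X_i ^+ 2) -> exists q, p = q * 'X_i ^+ 2.
Proof.
move=> u0 [q upq].
have [|u00|/var_dvdP[p1 p1E]] := @var_prime u p.
- by apply/var_dvdP; exists (q * 'X_i); rewrite upq expr2 mulrA.
- by rewrite u00 eqxx in u0.
have X0 : 'X_i != 0 :> S by rewrite -msize_poly_eq0 msizeX.
have up1 : u * p1 = q * 'X_i.
  by apply: (mulIf X0); rewrite -mulrA -p1E upq expr2 mulrA.
have [|u00|/var_dvdP[p2 p2E]] := @var_prime u p1.
- by apply/var_dvdP; exists q.
- by rewrite u00 eqxx in u0.
by exists p2; rewrite p1E p2E expr2 mulrA.
Qed.

End VariableDivides.

(** * The projection to a quotient as an algebra morphism *)

Section QuotientMap.
Variables (k : pzRingType) (A : comAlgType k) (I : idealr A).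

Definition quotient_map (a : A) : {ideal_quot I} := \pi a.

Lemma quotient_map_is_linear : linear quotient_map.
Proof.
move=> c a b; rewrite /quotient_map pi_addr; congr (_ + _).
exact/esym/pi_qscale.
Qed.

HB.instance Definition _ := GRing.isLinear.Build k A {ideal_quot I} _
  quotient_map quotient_map_is_linear.

Lemma quotient_map_is_monoid_morphism : monoid_morphism quotient_map.
Proof. by split=> [|a b]; rewrite /quotient_map ?pi_oner ?pi_mulr. Qed.

HB.instance Definition _ := GRing.isMonoidMorphism.Build A {ideal_quot I}
  quotient_map quotient_map_is_monoid_morphism.

End QuotientMap.

(** * The generic point and polynomial sections of the double hyperplane *)

Section DoubleHyperplane.
Variables (k : fieldType) (d : nat).
Local Notation S := {mpoly k[d.+2]}.
Local Notation X := (double_hyperplane k d).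
Local Notation x1 := (i1 d).
Local Notation Q := (coord_ring k d).

(** The image of the ideal of [x_1]. It cuts out the reduced hyperplane, so as a point of Proj it is
    the generic point. *)
Definition nilrad : set Q := [set a | exists q : S, a = \pi_Q (q * 'X_x1)].

Lemma nilradP (p : S) : nilrad (\pi_Q p) <-> kill_var x1 p = 0.
Proof.
split=> [[q] /eqP|/var_dvdP[q ->]]; last by exists q.
rewrite -Quotient.idealrBE => /sq_idealP[r /eqP]; rewrite subr_eq => /eqP ->.
by apply/var_dvdP; exists (r * 'X_x1 + q); rewrite mulrDl -mulrA -expr2.
Qed.

Lemma nilrad0 : nilrad 0.
Proof. by exists 0; rewrite mul0r pi_zeror. Qed.

Lemma nilradD a b : nilrad a -> nilrad b -> nilrad (a + b).
Proof.
by move=> [p ->] [q ->]; exists (p + q); rewrite mulrDl pi_addr.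
Qed.

Lemma nilradM (a b : Q) : nilrad b -> nilrad (a * b).
Proof.
by elim/quotW: a => a [q ->]; exists (a * q); rewrite -pi_mulr mulrA.
Qed.

Lemma kill_varU i : i != x1 -> kill_var x1 ('X_i : S) = 'X_i.
Proof. by move=> ix; rewrite kill_varX mnm1E (negPf ix). Qed.

Lemma nilrad1 : ~ nilrad 1.
Proof.
rewrite -pi_oner => /nilradP; rewrite /kill_var rmorph1 => /eqP.
by rewrite oner_eq0.
Qed.

Lemma nilrad_prime (a b : Q) : nilrad (a * b) -> nilrad a \/ nilrad b.
Proof.
elim/quotW: a => a; elim/quotW: b => b; rewrite -pi_mulr.
by move=> /nilradP/var_prime[] ?; [left|right]; apply/nilradP.
Qed.

Lemma nilrad_homog a : nilrad a -> exists N (f : nat -> Q),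
  (forall i, gr X i (f i) /\ nilrad (f i)) /\ a = \sum_(i < N) f i.
Proof.
move=> [q ->]; exists (msize q).+1.
(* The factor ['X_x1] raises degrees by one: the component in degree [j + 1] comes from that of [q]
   in degree [j], and the one in degree 0 is zero. *)
exists (fun i => if i is j.+1 then \pi_Q (pihomog mdeg j q * 'X_x1) else 0).
split=> [[|j]|].
- by split; [exact: gr0 | exact: nilrad0].
- split; last by exists (pihomog mdeg j q).
  exists (pihomog mdeg j q * 'X_x1) => //=; rewrite -[j.+1]addn1.
  by apply: dhomogM; [exact: pihomogP | rewrite dhomogX /= mdeg1].
rewrite big_ord_recl add0r /= -raddf_sum /= -mulr_suml.
by rewrite -pihomog_partitionE.
Qed.

Lemma nilrad_relevant : exists n a, [/\ (0 < n)%N, gr X n a & ~ nilrad a].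
Proof.
exists 1%N, (\pi_Q 'X_ord0); split=> //.
  by exists 'X_ord0 => //=; rewrite dhomogX /= mdeg1.
by move=> /nilradP/eqP; rewrite kill_varU // -msize_poly_eq0 msizeX.
Qed.

Definition generic_point : proj X := ProjPoint nilrad0 nilradD nilradM nilrad1
  nilrad_prime nilrad_homog nilrad_relevant.

Definition to_coord_ring (p : S) : Q := \pi_Q p.

Lemma to_coord_ring_is_linear : linear to_coord_ring.
Proof. exact: quotient_map_is_linear. Qed.

Lemma to_coord_ring_is_monoid_morphism : monoid_morphism to_coord_ring.
Proof. exact: quotient_map_is_monoid_morphism. Qed.

HB.instance Definition _ :=
  GRing.isLinear.Build k S Q _ to_coord_ring to_coord_ring_is_linear.
HB.instance Definition _ := GRing.isMonoidMorphism.Build S Q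
  to_coord_ring to_coord_ring_is_monoid_morphism.

Definition section_of (p : S) : germs X := to_germs (to_coord_ring p).

Lemma section_of_is_linear : linear section_of.
Proof.
by move=> c p q; rewrite /section_of linearP; exact: linearP.
Qed.

HB.instance Definition _ :=
  GRing.isLinear.Build k S (germs X) _ section_of section_of_is_linear.

Lemma section_of_is_monoid_morphism : monoid_morphism section_of.
Proof.
by split=> [|p q]; rewrite /section_of ?rmorph1 ?rmorphM.
Qed.

HB.instance Definition _ := GRing.isMonoidMorphism.Build S (germs X)
  section_of section_of_is_monoid_morphism.

Lemma section_ofZ c (p : S) : section_of (c *: p) = c *: section_of p.
Proof. exact: linearZ. Qed.

(* Outside the nilradical the elements of the coordinate ring are not zero
   divisors, so a section vanishing at the generic point is zero. *)
Lemma section_of_eq0 (p : S) : section_of p = 0 <->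
  (forall m : 'X_{1..d.+2}, (m x1 < 2)%N -> p@_m = 0).
Proof.
rewrite -sq_ideal_supp; split=> [/(to_germs_eq0 generic_point)[]|].
  elim/quotW=> u uN /(etrans (pi_mulr u p))/pi_coord_ring0/sq_idealP e.
  apply/sq_idealP; apply: var_cancel_sq e.
  by apply/negP => /eqP /nilradP.
move=> /pi_coord_ring0 p0.
exact: etrans (congr1 (@to_germs _ _ X) p0) (raddf0 _).
Qed.

Lemma section_of_twist n (p : S) :
  (forall m, m \in msupp p -> mdeg m = n) -> twist_sections n (section_of p).
Proof. by move=> pn; apply: to_germs_twist; exists p => //; apply/dhomogP. Qed.

Lemma mcoeff_comb_img (I : finType) (f : I -> 'X_{1..d.+2}) (c : I -> k) j :
  injective f -> (\sum_i c i *: 'X_[f i] : S)@_(f j) = c j.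
Proof.
move=> f_inj; rewrite raddf_sum (bigD1 j) //= big1 ?addr0 => [|i ij].
  by rewrite mcoeffZ mcoeffX eqxx mulr1.
by rewrite mcoeffZ mcoeffX (inj_eq f_inj) (negPf ij) mulr0.
Qed.

(** * Graded linear series spanned by monomials *)

Section MonomialSeries.
Variables (e : nat) (M : nat -> 'X_{1..d.+2} -> Prop).
Hypothesis M_deg : forall n m, M n m -> mdeg m = (e * n)%N.
Hypothesis M_0 : M 0 0%MM.
Hypothesis M_D : forall n n' m m', M n m -> M n' m' -> M (n + n') (m + m')%MM.

Definition monomial_gls (n : nat) : set (germs X) :=
  [set section_of p | p in [set p : S | forall m, m \in msupp p -> M n m]].

Lemma monomial_gls_sub n : (monomial_gls n `<=` twist_sections (e * n))%classic.
Proof. by move=> s [p pM <-]; apply: section_of_twist => m /pM/M_deg. Qed.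

Lemma monomial_gls0 n : monomial_gls n 0.
Proof. by exists 0; [move=> m; rewrite msupp0 | rewrite raddf0]. Qed.

Lemma monomial_glsP n (c : k) s t :
  monomial_gls n s -> monomial_gls n t -> monomial_gls n (c *: s + t).
Proof.
move=> [p pM <-] [q qM <-]; exists (c *: p + q); last by rewrite linearP.
by move=> m /msuppD_le; rewrite mem_cat => /orP[/msuppZ_le/pM|/qM].
Qed.

Lemma monomial_gls1 : monomial_gls 0 1.
Proof.
exists 1; last by rewrite rmorph1.
by move=> m; rewrite msupp1 inE => /eqP ->.
Qed.

Lemma monomial_glsM n n' s t :
  monomial_gls n s -> monomial_gls n' t -> monomial_gls (n + n') (s * t).
Proof.
move=> [p pM <-] [q qM <-]; exists (p * q); last by rewrite rmorphM.
by move=> m /msuppM_le /allpairsP[[u v] /= [/pM ? /qM ? ->]]; exact: M_D.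
Qed.

Definition monomial_series : graded_linear_series X e :=
  GradedLinearSeries monomial_gls_sub monomial_gls0 monomial_glsP
    monomial_gls1 monomial_glsM.

Lemma monomial_series_X n m : M n m -> monomial_series n (section_of 'X_[m]).
Proof. by move=> Mm; exists 'X_[m] => // u /mem_msuppXP <-. Qed.

(** The sections of the monomials ['X_[f i]] form a basis: by [section_of_eq0], a section determines
    exactly the coefficients at exponents with [m x1 < 2], and all other monomials map to zero. *)
Lemma monomial_series_dim n (I : finType) (f : I -> 'X_{1..d.+2}) :
  injective f -> (forall i, M n (f i)) -> (forall i, (f i x1 < 2)%N) ->
  (forall m, M n m -> (m x1 < 2)%N -> exists i, m = f i) ->
  has_dim (monomial_series n) #|I|.
Proof.
move=> f_inj fM f1 f_surj.
have g_inj : injective (f \o enum_val : 'I_#|I| -> _).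
  by apply: inj_comp => //; exact: enum_val_inj.
exists (fun j => section_of 'X_[f (enum_val j)]); split=> [j|c|_ [p pM <-]].
- exact: monomial_series_X.
- move=> c0 j; rewrite -(mcoeff_comb_img c j g_inj) /=.
  apply: (section_of_eq0 _).1; last exact: f1.
  rewrite raddf_sum -[RHS]c0; apply: eq_bigr => i _; exact: section_ofZ.
exists (fun j => p@_(f (enum_val j))).
under eq_bigr do rewrite -section_ofZ.
rewrite -raddf_sum; apply/eqP; rewrite -subr_eq0 -raddfB; apply/eqP.
apply/section_of_eq0 => m m1; rewrite mcoeffB.
have [/pM/f_surj/(_ m1)[i ->]|mp] := boolP (m \in msupp p).
  rewrite -[i]enum_rankK.
  by rewrite (mcoeff_comb_img _ _ g_inj) subrr.
rewrite (memN_msupp_eq0 mp) raddf_sum big1 ?subr0 // => j _ /=.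
rewrite mcoeffZ mcoeffX; case: eqP => [fm|]; last by rewrite mulr0.
by rewrite fm (memN_msupp_eq0 mp) mul0r.
Qed.

End MonomialSeries.

(** * Algebraic independence of monomial sections *)

Lemma section_of_monomials n (g : 'I_n -> S) (P : {mpoly k[n]}) :
  \sum_(u <- msupp P) P@_u *: \prod_(i < n) section_of (g i) ^+ u i =
  section_of (\sum_(u <- msupp P) P@_u *: \prod_(i < n) g i ^+ u i).
Proof.
rewrite raddf_sum; apply: eq_bigr => u _; rewrite [RHS]section_ofZ.
congr (_ *: _); rewrite rmorph_prod; apply: eq_bigr => i _.
by rewrite rmorphXn.
Qed.

(** Distinct exponents [u] give distinct monomials, all free of [x_1]. No cancellation occurs, so
    each coefficient of [P] reappears as a coefficient of the polynomial whose section vanishes. *)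
Lemma monomials_alg_indep n (g : 'I_n -> 'X_{1..d.+2}) :
  (forall i, g i x1 = 0%N) ->
  injective (fun u : 'X_{1..n} => \sum_(i < n) g i *+ u i)%MM ->
  alg_indep (fun i => section_of 'X_[g i]).
Proof.
move=> g1 g_inj P; rewrite section_of_monomials => /section_of_eq0 P0.
apply/mpolyP => u; rewrite mcoeff0.
pose h (u : 'X_{1..n}) := (\sum_(i < n) g i *+ u i)%MM.
have hE (v : 'X_{1..n}) : \prod_(i < n) 'X_[g i] ^+ v i = 'X_[h v] :> S.
  under eq_bigr do rewrite mpolyXn.
  by rewrite /h (big_morph _ (@mpolyXD _ _) (@mpolyX0 _ _)).
have h1 : (h u x1 < 2)%N.
  by rewrite mnm_sumE big1 // => i _; rewrite mulmnE g1.
have := P0 _ h1; rewrite raddf_sum /= => <-.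
rewrite {1}[P]mpolyE raddf_sum /=; apply: eq_bigr => v _.
by rewrite hE !mcoeffZ !mcoeffX (inj_eq g_inj).
Qed.

End DoubleHyperplane.

(** * Linear dependence and degree bounds *)

Lemma linear_dependence (F : fieldType) (I J : finType) (f : I -> J -> F) :
  (#|J| < #|I|)%N ->
  exists2 c : I -> F, exists i, c i != 0 & forall j, \sum_i c i * f i j = 0.
Proof.
move=> JI.
pose A := \matrix_(i < #|I|, j < #|J|) f (enum_val i) (enum_val j).
have : kermx A != 0.
  rewrite kermx_eq0 /row_free neq_ltn.
  by rewrite (leq_ltn_trans (rank_leq_col A)).
rewrite -nz_row_eq0; set v := nz_row _ => v0.
have /sub_kermxP vA : (v <= kermx A)%MS by exact: nz_row_sub.
exists (fun i => v 0 (enum_rank i)).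
  by case/rV0Pn: v0 => i vi; exists (enum_val i); rewrite enum_valK.
move=> j; move/rowP/(_ (enum_rank j)): vA; rewrite !mxE => vA.
rewrite -[RHS]vA (reindex _ (onW_bij _ (@enum_rank_bij I))).
by apply: eq_bigr => i _; rewrite mxE !enum_rankK.
Qed.

Section Degree.
Variables (R : nzRingType) (n : nat).
Implicit Types p q : {mpoly R[n]}.

(** Stated on supports rather than through [msize], which exceeds the degree by one: bounds then add
    under products, and the zero polynomial needs no special case. *)
Definition mdeg_bound D p := forall m, m \in msupp p -> (mdeg m <= D)%N.

Lemma mdeg_bound1 : mdeg_bound 0 1.
Proof. by move=> m; rewrite msupp1 inE => /eqP ->; rewrite mdeg0. Qed.

Lemma mdeg_boundM a b p q :
  mdeg_bound a p -> mdeg_bound b q -> mdeg_bound (a + b) (p * q).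
Proof.
move=> pa qb m /msuppM_le/allpairsP[[u v] /= [/pa ua /qb vb ->]].
by rewrite mdegD leq_add.
Qed.

Lemma mdeg_boundX a p e : mdeg_bound a p -> mdeg_bound (a * e) (p ^+ e).
Proof.
move=> pa; elim: e => [|e IHe]; first by rewrite muln0; exact: mdeg_bound1.
by rewrite exprS mulnS; exact: mdeg_boundM.
Qed.
End Degree.

Lemma mdeg_bound_prod (R : comNzRingType) n l D (p : 'I_l -> {mpoly R[n]}) u :
  (forall i, mdeg_bound D (p i)) ->
  mdeg_bound (D * mdeg u) (\prod_(i < l) p i ^+ u i).
Proof.
move=> pD; rewrite mdegE big_distrr /=.
apply: (big_ind2 (@mdeg_bound R n)) => [|a q b r|i _].
- exact: mdeg_bound1.
- exact: mdeg_boundM.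
- exact: mdeg_boundX.
Qed.

Lemma mnm_le_mdeg n (m : 'X_{1..n}) i : (m i <= mdeg m)%N.
Proof. by rewrite mdegE (bigD1 i) //= leq_addr. Qed.

(** * At most [d + 1] algebraically independent sections *)

Section UpperBound.
Variables (k : fieldType) (d : nat).
Local Notation S := {mpoly k[d.+2]}.
Local Notation x1 := (i1 d).

(** The boolean is the exponent of [x_1], since only the values 0 and 1 survive modulo [x_1 ^ 2]. *)
Definition box_mnm K (j : bool * {ffun 'I_d.+1 -> 'I_K}) : 'X_{1..d.+2} :=
  [multinom if unlift x1 i is Some i' then j.2 i' : nat else j.1 | i < d.+2].

Lemma box_mnm_surj K (m : 'X_{1..d.+2}) :
  (m x1 < 2)%N -> (mdeg m <= K)%N -> exists j, m = @box_mnm K.+1 j.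
Proof.
move=> m1 mK; exists (m x1 == 1%N, [ffun i => inord (m (lift x1 i))]).
apply/mnmP => i; rewrite mnmE /=; case: unliftP => [i' ->|->].
  rewrite ffunE inordK // ltnS; exact: leq_trans (mnm_le_mdeg _ _) mK.
by case: (m x1) m1 => [|[]].
Qed.

(* The N ^ n monomials with exponents below N in n independent sections would
   be independent, but they lie in a space of dimension O(N ^ (d + 1)). *)
Lemma alg_indep_sections_le n (y : 'I_n -> germs (double_hyperplane k d)) :
  (forall i, exists p : S, y i = section_of p) -> alg_indep y -> (n <= d.+1)%N.
Proof.
move=> /choice[p yp] y_indep; rewrite leqNgt; apply/negP => dn.
have {}yp : y = fun i => section_of (p i) by apply/funext.
rewrite {}yp in y_indep.
pose D := \max_i msize (p i).
have pD i : mdeg_bound D (p i).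
  move=> m /msize_mdeg_lt/ltnW/leq_trans; apply; exact: leq_bigmax.
(* Products with exponents below [N] have degree at most [C * N]. The choice of [N] gives [2 (C N +
   1)^(d+1) <= 2 (C + 1)^(d+1) N^(d+1) < N^(d+2) <= N^n], so there are more products than relevant
   coefficients. *)
pose C := (D * n)%N; pose N := (2 * C.+1 ^ d.+1).+1.
pose I := {ffun 'I_n -> 'I_N}.
pose J : finType := (bool * {ffun 'I_d.+1 -> 'I_(C * N).+1})%type.
have JI : (#|J| < #|I|)%N.
  rewrite card_prod card_bool !card_ffun !card_ord.
  apply: (@leq_trans (N ^ d.+2)); last by rewrite leq_pexp2l.
  rewrite [X in (_ < X)%N]expnS.
  apply: (@leq_ltn_trans (2 * (C.+1 * N) ^ d.+1)).
    by rewrite leq_mul2l leq_exp2r //= mulSn -addn1 addnC leq_add2r /N.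
  by rewrite expnMn mulnA ltn_mul2r expn_gt0 /= ltnS leqnn.
pose mu (i : I) : 'X_{1..n} := [multinom val (i j) | j < n].
have mu_inj : injective mu.
  move=> i i' /mnmP e; apply/ffunP => j; apply/val_inj.
  by have := e j; rewrite !mnmE.
pose q (u : 'X_{1..n}) : S := \prod_(i < n) p i ^+ u i.
have [c [i0 ci0] c0] := linear_dependence
  (fun (i : I) (j : J) => (q (mu i))@_(box_mnm j)) JI.
pose P : {mpoly k[n]} := \sum_i c i *: 'X_[mu i].
(* [P] evaluated at the sections is zero: its coefficients in degree at most [C * N] vanish by the
   choice of [c], those in higher degree by the degree bound. *)
have : P = 0.
  apply: y_indep; rewrite section_of_monomials.
  rewrite (_ : \sum_(u <- _) _ = \sum_i c i *: q (mu i)).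
    apply/section_of_eq0 => m m1; rewrite raddf_sum /=.
    have [mK|Km] := leqP (mdeg m) (C * N).
      have [j ->] := box_mnm_surj m1 mK.
      by rewrite -[RHS](c0 j); apply: eq_bigr => i _; rewrite mcoeffZ.
    rewrite big1 // => i _; rewrite mcoeffZ memN_msupp_eq0 ?mulr0 //.
    apply: contraL Km => /(mdeg_bound_prod pD) Km; rewrite -leqNgt.
    apply: leq_trans Km _; rewrite /C -mulnA leq_mul2l mdegE; apply/orP; right.
    rewrite -[X in (_ <= X * _)%N]card_ord -sum_nat_const.
    by apply: leq_sum => j _; rewrite mnmE; exact/ltnW/ltn_ord.
  (* Both sums are the substitution of the [p i] into [P]; passing through it avoids computing the
     support of [P]. *)
  transitivity (P \mPo [tuple p i | i < n]).
    rewrite comp_mpolyEX; apply: eq_bigr => u _; rewrite comp_mpolyX.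
    by congr (_ *: _); apply: eq_bigr => i _; rewrite tnth_mktuple.
  rewrite /P raddf_sum; apply: eq_bigr => i _ /=.
  rewrite comp_mpolyZ comp_mpolyX; congr (_ *: _).
  by apply: eq_bigr => j _; rewrite tnth_mktuple.
move/(congr1 (mcoeff (mu i0))); rewrite mcoeff0 /P raddf_sum (bigD1 i0) //=.
rewrite big1 => [|i ii0].
  by rewrite mcoeffZ mcoeffX eqxx mulr1 addr0 => /eqP; rewrite (negPf ci0).
by rewrite mcoeffZ mcoeffX (inj_eq mu_inj) (negPf ii0) mulr0.
Qed.

End UpperBound.

(** * The box series and its dimensions *)

Section BoxSeries.
Variables (k : fieldType) (d : nat) (sigma : nat -> nat).
Hypothesis d_gt0 : (0 < d)%N.
Hypothesis sigma_le : forall n, (sigma n <= n)%N.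
Hypothesis sigma_homo : {homo sigma : m n / (m <= n)%N}.
Local Notation x0 := (ord0 : 'I_d.+2).
Local Notation x1 := (i1 d).
Implicit Types (m : 'X_{1..d.+2}) (j : 'I_d).

Definition tail_var j : 'I_d.+2 := lift ord0 (lift ord0 j).

Lemma i1E : x1 = lift ord0 ord0. Proof. exact: val_inj. Qed.

Lemma mdeg_vars m : mdeg m = (m x0 + m x1 + \sum_j m (tail_var j))%N.
Proof. by rewrite mdegE !big_ord_recl i1E addnA. Qed.

(** The exponent of [x_0] is what remains of the total degree. *)
Lemma mnm_vars_eq m m' : mdeg m = mdeg m' -> m x1 = m' x1 ->
  (forall j, m (tail_var j) = m' (tail_var j)) -> m = m'.
Proof.
move=> e e1 ej; have e0 : m x0 = m' x0.
  move: e; rewrite !mdeg_vars e1 (eq_bigr _ (fun j _ => ej j)) => /addIn.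
  exact: addIn.
apply/mnmP => i; have [i' ->|->] := unliftP ord0 i => //.
by have [j ->|->] := unliftP ord0 i'; [exact: ej | rewrite -i1E].
Qed.

(* Only the cases m x1 = 0 and m x1 = 1 matter: the other monomials vanish on
   the double hyperplane. *)
Definition box_exponent n m : Prop := mdeg m = (2 * n)%N /\
  forall j, (d * m (tail_var j) + m x1 <= n + m x1 * sigma n)%N.

Lemma box_exponent_deg n m : box_exponent n m -> mdeg m = (2 * n)%N.
Proof. by case. Qed.

Lemma box_exponent0 : box_exponent 0 0%MM.
Proof. by split=> [|j]; rewrite ?mdeg0 // !mnmE muln0. Qed.

(** The defining inequalities add up, except for the terms in [sigma]; these only grow when [n] and
    [n'] are replaced by [n + n'], as [sigma] is nondecreasing. *)
Lemma box_exponentD n n' m m' :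
  box_exponent n m -> box_exponent n' m' -> box_exponent (n + n') (m + m')%MM.
Proof.
move=> [e mn] [e' mn']; split=> [|j]; first by rewrite mdegD e e' mulnDr.
rewrite !mnmDE mulnDr mulnDl addnACA [leqRHS]addnACA -[leqRHS]addnA.
have s : (m x1 * sigma n <= m x1 * sigma (n + n'))%N.
  by rewrite leq_mul2l sigma_homo ?orbT ?leq_addr.
have s' : (m' x1 * sigma n' <= m' x1 * sigma (n + n'))%N.
  by rewrite leq_mul2l sigma_homo ?orbT ?leq_addl.
by move: (mn j) (mn' j) s s'; lia.
Qed.

Definition box_series : graded_linear_series (double_hyperplane k d) 2 :=
  monomial_series k box_exponent_deg box_exponent0 box_exponentD.

Definition mnm_of (n c : nat) (a : 'I_d -> nat) : 'X_{1..d.+2} :=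
  [multinom if unlift ord0 i is Some i'
            then if unlift ord0 i' is Some j then a j else c
            else 2 * n - c - \sum_j a j | i < d.+2].

Lemma mnm_of0 n c a : mnm_of n c a x0 = (2 * n - c - \sum_j a j)%N.
Proof. by rewrite mnmE unlift_none. Qed.
Lemma mnm_of1 n c a : mnm_of n c a x1 = c.
Proof. by rewrite mnmE i1E liftK unlift_none. Qed.
Lemma mnm_of_var n c a j : mnm_of n c a (tail_var j) = a j.
Proof. by rewrite mnmE !liftK. Qed.

(** Summing the [d] bounds and dividing by [d] gives [c + \sum_j a j <= n + c * sigma n <= 2 * n].
    So the exponent of [x_0] is a genuine difference, and [2 * n] is just enough room. *)
Lemma mnm_of_box n (c : bool) a :
  (forall j, d * a j + c <= n + c * sigma n)%N -> box_exponent n (mnm_of n c a).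
Proof.
move=> aP; split=> [|j]; last by rewrite mnm_of1 mnm_of_var.
have da : (d * \sum_j a j <= d * (n + c * sigma n - c))%N.
  rewrite big_distrr /= -[X in (_ <= X * _)%N]card_ord -sum_nat_const.
  by apply: leq_sum => j _; move: (aP j); lia.
rewrite leq_pmul2l // in da.
have dn : (c + \sum_j a j <= 2 * n)%N.
  (* One instance of the hypothesis excludes [c = 1] with [n + sigma n = 0], where the subtraction
     in [da] would be truncated. *)
  move: da (aP (Ordinal d_gt0)) (sigma_le n); case: (c) => /=; lia.
rewrite mdeg_vars mnm_of0 mnm_of1 (eq_bigr _ (fun j _ => mnm_of_var n c a j)).
move: dn; set s := (\sum_j a j)%N; move: s (nat_of_bool c) => s c1 dn; lia.
Qed.

(** This is [floor((n + c sigma(n) - c) / d) + 1]. Adding [d] before subtracting [c] prevents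
    truncation and gives the correct width 0 when [c = 1] and [n = 0]. *)
Definition width n (c : bool) := ((n + c * sigma n + d - c) %/ d)%N.

Lemma lt_width n (c : bool) a :
  (a < width n c)%N = (d * a + c <= n + c * sigma n)%N.
Proof.
rewrite /width leq_divRL // mulSn [(a * d)%N]mulnC.
by move: d_gt0; case: (c) => /=; lia.
Qed.

Definition box_index n (c : bool) := {ffun 'I_d -> 'I_(width n c)}.

Definition box_basis n (u : box_index n false + box_index n true) :=
  match u with
  | inl a => mnm_of n false (fun j => a j)
  | inr a => mnm_of n true (fun j => a j)
  end.

Lemma mnm_of_inj n c (a a' : box_index n c) :
  mnm_of n c (fun j => a j) = mnm_of n c (fun j => a' j) -> a = a'.
Proof.
move=> /mnmP e; apply/ffunP => j; apply/val_inj.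
by have := e (tail_var j); rewrite !mnm_of_var.
Qed.

Lemma box_basis_inj n : injective (@box_basis n).
Proof.
move=> [] a [] a' /= e; try by move: e => /mnm_of_inj ->.
  by move: e => /mnmP/(_ x1); rewrite !mnm_of1.
by move: e => /mnmP/(_ x1); rewrite !mnm_of1.
Qed.

Lemma mnm_of_surj n (c : bool) m : box_exponent n m -> m x1 = c ->
  exists a : box_index n c, m = mnm_of n c (fun j => a j).
Proof.
move=> [e mP] m1.
have aP j : (m (tail_var j) < width n c)%N by rewrite lt_width -m1.
exists [ffun j => Ordinal (aP j)]; apply: mnm_vars_eq => [||j].
- rewrite e (mnm_of_box _).1 // => j.
  by rewrite ffunE -lt_width.
- by rewrite mnm_of1.
- by rewrite mnm_of_var ffunE.
Qed.

Lemma box_series_dim n :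
  has_dim (box_series n) (width n false ^ d + width n true ^ d).
Proof.
have -> : (width n false ^ d + width n true ^ d)%N =
    #|{: box_index n false + box_index n true}|.
  by rewrite card_sum !card_ffun !card_ord.
apply: (@monomial_series_dim k d 2 box_exponent _ _ _ n _ (@box_basis n)).
- exact: box_basis_inj.
- by case=> a; apply: mnm_of_box => j; rewrite -lt_width.
- by case=> a /=; rewrite mnm_of1.
move=> m mM m2; case m1: (m x1) m2 => [|[|]] // _.
  by have [a ->] := @mnm_of_surj n false m mM m1; exists (inl a).
by have [a ->] := @mnm_of_surj n true m mM m1; exists (inr a).
Qed.

(** * The Kodaira-Iitaka dimension of the box series *)

Definition indep_exponent (i : 'I_d.+1) : 'X_{1..d.+2} :=
  if unlift ord0 i is Some j then (U_(tail_var j) + U_(ord0) *+ (2 * d).-1)%MM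
  else (U_(ord0) *+ 2)%MM.

Lemma indep_exponent1 i : indep_exponent i x1 = 0%N.
Proof.
rewrite /indep_exponent; case: unliftP => [j|] _.
  by rewrite mnmDE mulmnE !mnm1E.
by rewrite mulmnE mnm1E.
Qed.

(** The monomials are [t_0^2] in [L_1] and [t_i t_0^(2d-1)] in [L_d] for [i >= 1]: the bound
    [d u_i <= n] first allows [t_i] at [n = d], and [t_0] fills the degree up to [2d]. *)
Lemma indep_exponent_box i :
  exists2 n, (0 < n)%N & box_exponent n (indep_exponent i).
Proof.
have := indep_exponent1 i.
rewrite /indep_exponent; case: unliftP => [j|] _ e1.
  exists d => //; split=> [|j']; last first.
    rewrite e1 !addn0 mnmDE mulmnE !mnm1E addn0.
    by case: eqP => _; rewrite ?muln0 ?muln1.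
  by rewrite mdegD mdegMn !mdeg1 mul1n; move: d_gt0; lia.
exists 1%N => //; split=> [|j']; first by rewrite mdegMn mdeg1.
by rewrite e1 mulmnE mnm1E muln0.
Qed.

(** The system is triangular: the exponent of [tail_var j] is [u (lift ord0 j)], and once these are
    known the exponent of [x_0] determines [u ord0]. *)
Lemma indep_exponent_inj :
  injective (fun u : 'X_{1..d.+1} =>
    \sum_(i < d.+1) indep_exponent i *+ u i)%MM.
Proof.
move=> u u' /mnmP e.
have ev j : u (lift ord0 j) = u' (lift ord0 j).
  suff val_var w : (\sum_(i < d.+1) indep_exponent i *+ w i)%MM (tail_var j) =
      w (lift ord0 j) by rewrite -!val_var e.
  rewrite mnm_sumE big_ord_recl (bigD1 j) //= big1 => [|i ij].
    rewrite !mulmnE /indep_exponent unlift_none liftK mnmDE !mulmnE !mnm1E eqxx.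
    by rewrite !mul0n addn0 mul1n.
  rewrite mulmnE /indep_exponent liftK mnmDE mulmnE !mnm1E.
  by rewrite (inj_eq lift_inj) (inj_eq lift_inj) (negPf ij).
apply/mnmP => i; have [j ->|->] := unliftP ord0 i; first exact: ev.
have val0 w : (\sum_(i < d.+1) indep_exponent i *+ w i)%MM x0 =
    (2 * w ord0 + (2 * d).-1 * \sum_j w (lift ord0 j))%N.
  rewrite mnm_sumE big_ord_recl big_distrr /=; congr (_ + _)%N.
    by rewrite !mulmnE /indep_exponent unlift_none mulmnE mnm1E.
  apply: eq_bigr => j _.
  by rewrite mulmnE /indep_exponent liftK mnmDE mulmnE !mnm1E eqxx mul1n.
have := e x0; rewrite !val0 (eq_bigr _ (fun j _ => ev j)) => /addIn.
by lia.
Qed.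

Lemma box_series_sigma : is_sigma box_series d.+1.
Proof.
split=> [|n [y yL]]; last first.
  by apply: alg_indep_sections_le => i; have [? _ [p _ <-]] := yL i; exists p.
exists (fun i => section_of 'X_[indep_exponent i]) => [i|].
  have [n n0 iM] := indep_exponent_box i.
  by exists n => //; exact: monomial_series_X.
exact: (monomials_alg_indep indep_exponent1 indep_exponent_inj).
Qed.

End BoxSeries.

(** * The largest power of two up to [n] *)

Definition pow2_floor (n : nat) : nat := ((0 < n) * 2 ^ trunc_log 2 n)%N.

(** The factor [(0 < n)] matters at [n = 0], where [2 ^ trunc_log 2 n] is 1. *)
Lemma pow2_floor_le n : (pow2_floor n <= n)%N.
Proof. by case: n => // n; rewrite /pow2_floor mul1n trunc_logP. Qed.

Lemma pow2_floor_homo : {homo pow2_floor : m n / (m <= n)%N}.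
Proof.
move=> [//|m] [//|n] mn; rewrite /pow2_floor !mul1n leq_exp2l //.
exact: leq_trunc_log.
Qed.

Lemma pow2_floorE j n : (2 ^ j <= n < 2 ^ j.+1)%N -> pow2_floor n = (2 ^ j)%N.
Proof.
move=> jn; have n0 : (0 < n)%N.
  by case/andP: jn => /(leq_trans _) -> //; rewrite expn_gt0.
by rewrite /pow2_floor n0 mul1n (trunc_log_eq _ jn).
Qed.

(** * Limits along sequences close to multiples of powers of two *)

Section Limits.
Variable R : realType.
Local Notation h j := ((2^-1 : R) ^+ j).

Lemma cvgrX (T : Type) (F : set_system T) (f : T -> R) (l : R) n : Filter F ->
  f x @[x --> F] --> l -> f x ^+ n @[x --> F] --> l ^+ n.
Proof.
move=> FF fl; elim: n => [|n IHn].
  by rewrite expr0; under eq_fun do rewrite expr0; exact: cvg_cst.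
by rewrite exprS; under eq_fun do rewrite exprS; exact: cvgM.
Qed.

(** The hypothesis says that [w j] is [(p / q) 2^j] up to a bounded error, so after scaling by
    [2^-j] it is squeezed between [p / q - C 2^-j] and [p / q + C 2^-j]. *)
Lemma cvg_ratio_pow2 (w : nat -> nat) (p q C : nat) : (0 < q)%N ->
  (\forall j \near \oo,
     (w j * q <= p * 2 ^ j + C)%N /\ (p * 2 ^ j <= w j * q + C)%N) ->
  (w j)%:R * h j @[j --> \oo] --> (p%:R / q%:R : R).
Proof.
move=> q0 wP.
have h0 : (C%:R * h j) @[j --> \oo] --> (0 : R).
  rewrite -[X in _ --> X](mulr0 C%:R); apply: cvgMr.
  by apply: cvg_expr; rewrite gtr0_norm; lra.
apply: (@squeeze_cvgr _ _ _ _
  (fun j => p%:R / q%:R - C%:R * h j)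
  (fun j => p%:R / q%:R + C%:R * h j)); last 2 first.
- by rewrite -[X in _ --> X]subr0; apply: cvgB => //; exact: cvg_cst.
- by rewrite -[X in _ --> X]addr0; apply: cvgD => //; exact: cvg_cst.
near=> j.
have [wl wu] : (w j * q <= p * 2 ^ j + C)%N /\ (p * 2 ^ j <= w j * q + C)%N.
  by near: j.
have hj : (2 ^ j)%:R * h j = 1 :> R.
  by rewrite natrX -exprMn mulfV ?pnatr_eq0 // expr1n.
have h_gt0 : 0 < h j by rewrite exprn_gt0 // invr_gt0 ltr0n.
have qR : 1 <= q%:R :> R by rewrite ler1n.
have q0R : 0 < q%:R :> R by rewrite ltr0n.
move: wl wu; rewrite -!(ler_nat R) !natrD !natrM => wl wu.
have Cq : C%:R * h j <= C%:R * h j * q%:R.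
  by rewrite ler_peMr // mulr_ge0 // ltW.
rewrite -(ler_pM2r q0R) -[X in _ && X](ler_pM2r q0R) mulrBl mulrDl.
rewrite mulfVK ?lt0r_neq0 //.
move: (ler_wpM2r (ltW h_gt0) wl) (ler_wpM2r (ltW h_gt0) wu).
rewrite !mulrDl -[p%:R * _ * _]mulrA hj mulr1 => wl' wu'.
by apply/andP; split; lra.
Unshelve. all: by end_near.
Qed.

Variables (d a r : nat).
Hypotheses (d_gt0 : (0 < d)%N) (r_gt0 : (0 < r)%N).

Definition box_dim n :=
  (width d pow2_floor n false ^ d + width d pow2_floor n true ^ d)%N.

(** When [n j] is [nu 2^j] up to a bounded error and [sigma] takes the value [2^j], the two widths
    are [nu 2^j / d] and [(nu + 1) 2^j / d] up to bounded errors. *)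
Lemma box_dim_cvg (n : nat -> nat) (nu C : nat) : (0 < nu)%N ->
  (\forall j \near \oo, [/\ pow2_floor (n j) = (2 ^ j)%N,
     (n j <= nu * 2 ^ j + C)%N & (nu * 2 ^ j <= n j + C)%N]) ->
  (box_dim (n j))%:R / (n j)%:R ^+ d @[j --> \oo] -->
    (((nu%:R / d%:R) ^+ d + (nu.+1%:R / d%:R) ^+ d) / nu%:R ^+ d : R).
Proof.
move=> nu0 nP.
have n_cvg : (n j)%:R * h j @[j --> \oo] --> (nu%:R : R).
  rewrite -[X in _ --> X]divr1; apply: (@cvg_ratio_pow2 n nu 1 C) => //.
  by near=> j; rewrite muln1; have [] : [/\ pow2_floor (n j) = (2 ^ j)%N,
     (n j <= nu * 2 ^ j + C)%N & (nu * 2 ^ j <= n j + C)%N] by near: j.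
have w0_cvg : (width d pow2_floor (n j) false)%:R * h j @[j --> \oo] -->
    (nu%:R / d%:R : R).
  apply: (@cvg_ratio_pow2 _ nu d (C + d)) => //; near=> j.
  have [_ n1 n2] : [/\ pow2_floor (n j) = (2 ^ j)%N,
     (n j <= nu * 2 ^ j + C)%N & (nu * 2 ^ j <= n j + C)%N] by near: j.
  rewrite /width mul0n addn0 subn0.
  move: (leq_divM (n j + d) d) (ltn_ceil (n j + d) d_gt0) n1 n2.
  by rewrite mulSn; lia.
have w1_cvg : (width d pow2_floor (n j) true)%:R * h j @[j --> \oo] -->
    (nu.+1%:R / d%:R : R).
  apply: (@cvg_ratio_pow2 _ nu.+1 d (C + d)) => //; near=> j.
  have [s n1 n2] : [/\ pow2_floor (n j) = (2 ^ j)%N,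
     (n j <= nu * 2 ^ j + C)%N & (nu * 2 ^ j <= n j + C)%N] by near: j.
  rewrite /width mul1n s mulSn.
  move: (leq_divM (n j + 2 ^ j + d - 1) d)
    (ltn_ceil (n j + 2 ^ j + d - 1) d_gt0) n1 n2 d_gt0.
  by rewrite mulSn; lia.
(* Numerator and denominator are both scaled by [2^(-jd)]. *)
have E j : (box_dim (n j))%:R / (n j)%:R ^+ d =
    (((width d pow2_floor (n j) false)%:R * h j) ^+ d +
     ((width d pow2_floor (n j) true)%:R * h j) ^+ d) /
    ((n j)%:R * h j) ^+ d :> R.
  rewrite natrD !natrX !exprMn -mulrDl -mulf_div divff ?mulr1 //.
  by rewrite !expf_neq0 // invr_neq0 // pnatr_eq0.
under eq_fun do rewrite E.
apply: cvgM.
  by apply: cvgD; apply: cvgrX.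
apply: cvgV; last exact: cvgrX.
by rewrite expf_neq0 // pnatr_eq0 -lt0n.
Unshelve. all: by end_near.
Qed.

(** * Two subsequences of an arithmetic progression *)

Definition step j := ((2 ^ j - 1 - a) %/ r)%N.

(** [step j] is the last index whose term is below [2^j], so this term and the next one straddle
    [2^j], each within distance [r]. *)
Lemma stepP j : (a < 2 ^ j)%N ->
  (a + step j * r < 2 ^ j)%N /\ (2 ^ j <= a + step j * r + r)%N.
Proof.
move=> aj; have := leq_divM (2 ^ j - 1 - a) r.
have := ltn_ceil (2 ^ j - 1 - a) r_gt0; rewrite -/(step j) mulSn.
by move: aj; lia.
Qed.

Lemma near_pow2_gt A : \forall j \near \oo, (A < 2 ^ j)%N.
Proof.
exists A => // j /= Aj; apply: leq_ltn_trans Aj _; exact: ltn_expl.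
Qed.

Lemma step_cvg : step j @[j --> \oo] --> \oo.
Proof.
apply/cvgnyPge => A; have := near_pow2_gt (a + A * r + r).
apply: filterS => j aj; rewrite /step leq_divRL //.
by move: aj; lia.
Qed.

Lemma box_dim_not_cvg :
  ~ exists l : R,
      (box_dim (a + b * r))%:R / (a + b * r)%:R ^+ d @[b --> \oo] --> l.
Proof.
move=> [l fl].
pose f b : R := (box_dim (a + b * r))%:R / (a + b * r)%:R ^+ d.
have low : f (step j.+1) @[j --> \oo] --> l.
  apply: (@cvg_comp _ _ _ (fun j => step j.+1) f _ \oo) fl.
  by rewrite (cvg_shiftS step); exact: step_cvg.
have high : f (step j).+1 @[j --> \oo] --> l.
  apply: (@cvg_comp _ _ _ (fun j => (step j).+1) f _ \oo) fl.
  apply/cvgnyPge => A; move/cvgnyPge: step_cvg => /(_ A).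
  by apply: filterS => j /leqW.
(* Terms just below [2^(j+1)] have [sigma] equal to [2^j] and ratio [nu = 2]; terms just after [2^j]
   have the same [sigma] and [nu = 1]. The error constant is [r] in both cases. *)
have low' := @box_dim_cvg (fun j => a + step j.+1 * r)%N 2 r isT.
have high' := @box_dim_cvg (fun j => a + (step j).+1 * r)%N 1 r isT.
have : l = ((2%:R / d%:R) ^+ d + (3%:R / d%:R) ^+ d) / 2%:R ^+ d.
  apply: (cvg_unique _ low) => //; apply: low'.
  have := near_pow2_gt (a + r); apply: filterS => j aj.
  have aj' : (a < 2 ^ j.+1)%N by rewrite expnS; move: aj; lia.
  have [s1 s2] := stepP aj'; rewrite expnS in s1 s2; split.
  - apply: pow2_floorE; rewrite expnS.
    by apply/andP; split; move: aj s2 s1; lia.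
  - by move: s1; lia.
  - by move: s2; lia.
have -> : l = ((1%:R / d%:R) ^+ d + (2%:R / d%:R) ^+ d) / 1%:R ^+ d.
  apply: (cvg_unique _ high) => //; apply: high'.
  have := near_pow2_gt (a + r); apply: filterS => j aj.
  have aj' : (a < 2 ^ j)%N by move: aj; lia.
  have [s1 s2] := stepP aj'; rewrite mulSn; split.
  - apply: pow2_floorE; rewrite expnS.
    by apply/andP; split; move: aj s2 s1; lia.
  - by move: s1; lia.
  - by move: s2; lia.
rewrite !expr_div_n !expr1n -!natrX => e.
have natR_neq0 n : (0 < n)%N -> n%:R != 0 :> R by rewrite pnatr_eq0 lt0n.
have d0 : (d ^ d)%:R != 0 :> R by rewrite natR_neq0 ?expn_gt0 ?d_gt0.
have x0 : (2 ^ d)%:R != 0 :> R by rewrite natR_neq0 ?expn_gt0.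
(* Clearing denominators in the equality of the two limits leaves [x + x^2 = x + y] with [x = 2^d]
   and [y = 3^d], hence [4^d = 3^d], absurd for [d > 0]. *)
have : (2 ^ d * 2 ^ d)%:R = (3 ^ d)%:R :> R.
  rewrite natrM; set x := (2 ^ d)%:R in e x0 *; set z := (d ^ d)%:R in e d0.
  set y := (3 ^ d)%:R in e *.
  have {}e := congr1 (fun t => t * z * x) e.
  have e1 : (1 / z + x / z) / 1 * z * x = x + x * x by field.
  have e2 : (x / z + y / z) / x * z * x = x + y by field; rewrite d0 x0.
  by move: e; rewrite e1 e2 => /addrI.
move=> /eqP; rewrite eqr_nat -expnMn => /eqP/(@expIn d).
by move/(_ d_gt0).
Qed.

End Limits.

Theorem mainTheorem4 (R : realType) (k : fieldType) (d : nat) (hd : (1 <= d)%N) :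
  exists L : graded_linear_series (double_hyperplane k d) 2,
    is_kodaira_iitaka_dim L (d%:Z)%:E /\
    exists2 dimL : nat -> nat, (forall n, has_dim (L n) (dimL n)) &
      forall a r : nat, (0 < r)%N ->
        ~ exists l : R,
            (dimL (a + b * r)%N)%:R / (a + b * r)%:R ^+ d @[b --> \oo] --> l.
Proof.
exists (box_series k hd pow2_floor_homo); split.
  by exists d.+1 => //; exact: box_series_sigma.
exists (box_dim d) => [n|a r r_gt0]; last exact: box_dim_not_cvg.
exact: (box_series_dim _ _ pow2_floor_le).
Qed.
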